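(* Let $p\in[0,1]$ and let $\mathcal{N}$ be the single-qubit dephasing channel with Kraus operators $K_1=\sqrt{1-\frac p2}\,\mathbb{1}$, $K_2=\sqrt{\frac p2}\,Z$. Then the Kraus decomposition $K^{(U)}_{i'}=\sum_{i=1}^2U_{i'i}K_i$, $i'\in\{1,2\}$, obtained with the rotation $$U=\frac{1}{\sqrt2}\begin{pmatrix}1&1\\1&-1\end{pmatrix}$$ is optimal for the Choi state of $\mathcal{N}$.
   Context: Let $|\omega\rangle=\frac1{\sqrt2}(|00\rangle+|11\rangle)$ and let $\mathrm{C}(\mathcal{N})=(\mathcal{N}\otimes\mathcal{I})[|\omega\rangle\langle\omega|]$ be the Choi state of a single-qubit channel $\mathcal{N}$. A Kraus decomposition $\{K_i\}_i$ of $\mathcal{N}$ induces the ensemble decomposition $\{p_i,|\phi_i\rangle\}_i$ of $\mathrm{C}(\mathcal{N})$ with $p_i=\|(K_i\otimes\mathbb{1})|\omega\rangle\|_2^2$ and $|\phi_i\rangle=p_i^{-1/2}(K_i\otimes\mathbb{1})|\omega\rangle$. It is called optimal for the Choi state if $\sum_ip_iE(|\phi_i\rangle)=E_{\mathrm{oF}}(\mathrm{C}(\mathcal{N}))$, where $E(|\phi\rangle)=-\mathrm{Tr}[\rho_A\log_2\rho_A]$ ($\rho_A$ the reduced state on the first qubit) and the entanglement of formation $E_{\mathrm{oF}}(\rho)$ is the infimum of $\sum_iq_iE(|\varphi_i\rangle)$ over all pure-state ensemble decompositions $\rho=\sum_iq_i|\varphi_i\rangle\langle\varphi_i|$. $Z=\mathrm{diag}(1,-1)$.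 *)

(* Defs.v *)
From HB Require Import structures.
From mathcomp Require Import all_boot all_order all_algebra.
From mathcomp Require Import complex mxtens.
From mathcomp Require Import boolp classical_sets reals exp.

Set Implicit Arguments.
Unset Strict Implicit.
Unset Printing Implicit Defensive.

Import Order.TTheory GRing.Theory Num.Theory.

Local Open Scope ring_scope.
Local Open Scope sesquilinear_scope.
Local Open Scope complex_scope.

Section Hilbert.
Variable R : realType.
Local Notation C := R[i].

Definition sqnorm n (v : 'cV[C]_n) : R := \sum_i ComplexField.Normc.normc (v i 0) ^+ 2.

Definition proj n (v : 'cV[C]_n) : 'M[C]_n := v *m v ^t*.

Definition log2 (x : R) : R := ln x / ln 2.

(* Functional calculus f(A) of a Hermitian A, whose eigenvalues are real:
   with A = P^-1 diag(d) P, P unitary, f(A) = P^-1 diag(f(d)) P. *)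
Definition hermfun (f : R -> R) n (A : 'M[C]_n) : 'M[C]_n :=
  invmx (spectralmx A)
    *m diag_mx (map_mx (fun z : C => (f (complex.Re z))%:C) (spectral_diag A))
    *m spectralmx A.

(* -Tr[rho log2 rho]; since ln 0 = 0, zero eigenvalues contribute 0,
   which is the usual convention 0 log 0 = 0. *)
Definition vN_entropy n (rho : 'M[C]_n) : R :=
  - complex.Re (\tr (rho *m hermfun log2 rho)).

(* In 'M_(m * n) the row index (i, k) is mxtens_index (i, k), as in A *t B. *)
Definition ptrace2 m n (rho : 'M[C]_(m * n)) : 'M[C]_m :=
  \matrix_(i, j) \sum_(k < n) rho (mxtens_index (i, k)) (mxtens_index (j, k)).

Definition entanglement m n (phi : 'cV[C]_(m * n)) : R :=
  vN_entropy (ptrace2 (proj phi)).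

Definition is_ensemble d (rho : 'M[C]_d) k (q : 'I_k -> R)
    (phi : 'I_k -> 'cV[C]_d) : Prop :=
  [/\ forall i, 0 <= q i, \sum_i q i = 1, forall i, sqnorm (phi i) = 1 &
      rho = \sum_i (q i)%:C *: proj (phi i)].

Definition average_entanglement m n k (q : 'I_k -> R)
    (phi : 'I_k -> 'cV[C]_(m * n)) : R :=
  \sum_i q i * entanglement (phi i).

Definition EoF m n (rho : 'M[C]_(m * n)) : R :=
  inf [set x | exists k (q : 'I_k -> R) (phi : 'I_k -> 'cV[C]_(m * n)),
         is_ensemble rho q phi /\ x = average_entanglement q phi]%classic.

End Hilbert.

Section Channels.
Variable R : realType.
Local Notation C := R[i].

Definition kraus_map k (K : 'I_k -> 'M[C]_2) (X : 'M[C]_2) : 'M[C]_2 :=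
  \sum_i K i *m X *m (K i) ^t*.

Lemma kraus_map_is_linear k (K : 'I_k -> 'M[C]_2) : linear (kraus_map K).
Proof.
move=> a X Y; rewrite /kraus_map scaler_sumr -big_split /=.
by apply: eq_bigr => i _; rewrite mulmxDr mulmxDl -scalemxAr -scalemxAl.
Qed.

HB.instance Definition _ k (K : 'I_k -> 'M[C]_2) :=
  GRing.isLinear.Build C 'M[C]_2 'M[C]_2 *:%R (kraus_map K)
    (kraus_map_is_linear K).

Definition kraus_decomposition k (K : 'I_k -> 'M[C]_2)
    (N : {linear 'M[C]_2 -> 'M[C]_2}) : Prop :=
  forall X, N X = kraus_map K X.

(* N (x) I: write X = sum_(k, l) X_kl (x) |k><l| with X_kl the 2 x 2 matrix
   (X_kl)_ij = X_(i,k),(j,l), and apply N to each X_kl. *)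
Definition on_first (N : {linear 'M[C]_2 -> 'M[C]_2}) (X : 'M[C]_(2 * 2)) :
    'M[C]_(2 * 2) :=
  \sum_(k < 2) \sum_(l < 2)
    N (\matrix_(i, j) X (mxtens_index (i, k)) (mxtens_index (j, l)))
      *t delta_mx k l.

Definition ket (i : 'I_2) : 'cV[C]_2 := delta_mx i 0.

Definition omega : 'cV[C]_(2 * 2) :=
  ((Num.sqrt 2)^-1)%:C *: (ket 0 *t ket 0 + ket 1 *t ket 1).

Definition choi (N : {linear 'M[C]_2 -> 'M[C]_2}) : 'M[C]_(2 * 2) :=
  on_first N (proj omega).

Definition kraus_vec (A : 'M[C]_2) : 'cV[C]_(2 * 2) :=
  (A *t (1%:M : 'M_2)) *m omega.

Definition kraus_prob k (K : 'I_k -> 'M[C]_2) (i : 'I_k) : R :=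
  sqnorm (kraus_vec (K i)).

(* Outcomes of probability 0 get the zero vector, with weight 0. *)
Definition kraus_state k (K : 'I_k -> 'M[C]_2) (i : 'I_k) : 'cV[C]_(2 * 2) :=
  ((Num.sqrt (kraus_prob K i))^-1)%:C *: kraus_vec (K i).

Definition choi_optimal k (K : 'I_k -> 'M[C]_2)
    (N : {linear 'M[C]_2 -> 'M[C]_2}) : Prop :=
  kraus_decomposition K N /\
  average_entanglement (kraus_prob K) (kraus_state K) = EoF (choi N).

Definition rotate_kraus k' k (U : 'M[C]_(k', k)) (K : 'I_k -> 'M[C]_2)
    (i' : 'I_k') : 'M[C]_2 :=
  \sum_i U i' i *: K i.

Definition pauliZ : 'M[C]_2 := diag_mx (\row_j (-1) ^+ j).

Definition dephasing_kraus (p : R) (i : 'I_2) : 'M[C]_2 :=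
  if i == 0 then (Num.sqrt (1 - p / 2))%:C *: 1%:M
  else (Num.sqrt (p / 2))%:C *: pauliZ.

(* The matrix with rows (1, 1) and (1, -1), divided by sqrt 2. *)
Definition hadamard : 'M[C]_2 :=
  ((Num.sqrt 2)^-1)%:C *: \matrix_(i, j) (-1) ^+ (i * j).

End Channels.

(* Main.v *)
(* The Choi state has rank two and lives on span{|00>, |11>}, so every pure
   state of one of its ensembles is x|00> + y|11>, with entropy depending only
   on |x| and |y|. Its coherence between |00> and |11> is (1 - p)/2; it is the
   average of x conj(y), hence at most the average of |x||y|. The entropy is a
   nondecreasing convex function of the concurrence 2|x||y|; its tangent line at
   concurrence 1 - p bounds the average entropy from below, and both states of
   the rotated decomposition sit at that point. With |x|/|y| = e^t the tangent
   inequality becomes a statement on hyperbolic functions: 2|x||y| = 1/cosh t,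
   the entropy (in nats) is ln (2 cosh t) - t tanh t, and the difference with
   a line of slope m has derivative (m sinh t - t)/cosh^2 t, whose sign is given
   by the monotonicity of sinh t / t. *)
Require Import Defs.
From mathcomp Require Import all_boot all_order all_algebra.
From mathcomp Require Import complex mxtens spectral.
From mathcomp Require Import reals topology.
From mathcomp Require Import normedtype sequences derive realfun exp.
From mathcomp Require Import ring lra.

Set Implicit Arguments.
Unset Strict Implicit.
Unset Printing Implicit Defensive.

Import Order.TTheory GRing.Theory Num.Theory numFieldNormedType.Exports.

Local Open Scope ring_scope.
Local Open Scope sesquilinear_scope.
Local Open Scope complex_scope.

(** * Hyperbolic inequalities and tangents to the entropy curve *)

Section Hyperbolic.
Variable R : realType.
Implicit Types s t : R.

(** Mean value theorem. The sign condition is confined to [[a, b]], so the lemma applies separately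
    on each side of a minimum. *)
Lemma is_derive_ge0_le (f f' : R -> R) (a b : R) : a <= b ->
  (forall t, is_derive t 1 f (f' t)) ->
  (forall t, a <= t <= b -> 0 <= f' t) -> f a <= f b.
Proof.
move=> ab df f'0.
have [|c cab fE] := @MVT_segment R f f' a b ab (fun t _ => df t).
  apply: derivable_within_continuous => x _.
  exact: (@ex_derive _ _ _ _ _ _ _ (df x)).
by rewrite -subr_ge0 fE mulr_ge0 ?subr_ge0// f'0.
Qed.

Definition cosh t := (expR t + expR (- t)) / 2.
Definition sinh t := (expR t - expR (- t)) / 2.

Lemma is_derive_expRN t :
  is_derive t 1 (fun u : R => expR (- u)) (- expR (- t)).
Proof.
have /is_derive_eq : is_derive t 1 (expR \o -%R) (expR (- t) * -1).
  exact: is_derive1_comp.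
by apply; rewrite mulrN1.
Qed.

Lemma is_derive_cosh t : is_derive t 1 cosh (sinh t).
Proof.
have /is_derive_eq := is_deriveM
  (is_deriveD (is_derive_expR t) (is_derive_expRN t))
  (is_derive_cst (2^-1 : R) t 1).
by apply; rewrite scaler0 add0r /GRing.scale /= mulrC.
Qed.

Lemma is_derive_sinh t : is_derive t 1 sinh (cosh t).
Proof.
have /is_derive_eq := is_deriveM
  (is_deriveB (is_derive_expR t) (is_derive_expRN t))
  (is_derive_cst (2^-1 : R) t 1).
by apply; rewrite scaler0 add0r opprK /GRing.scale /= mulrC.
Qed.

Lemma sinh0 : sinh 0 = 0.
Proof. by rewrite /sinh oppr0 subrr mul0r. Qed.

Lemma cosh0 : cosh 0 = 1.
Proof. by rewrite /cosh oppr0 expR0; lra. Qed.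

Lemma cosh_gt0 t : 0 < cosh t.
Proof. by rewrite /cosh divr_gt0// addr_gt0 ?expR_gt0. Qed.

Lemma cosh2B t : cosh t ^+ 2 - sinh t ^+ 2 = 1.
Proof. by have := expRxMexpNx_1 t; rewrite /cosh /sinh; nra. Qed.

Lemma cosh_ge1 t : 1 <= cosh t.
Proof. by have := cosh2B t; have := cosh_gt0 t; nra. Qed.

(** [sinh u - u] vanishes at 0 and has derivative [cosh u - 1]. *)
Lemma le_sinh t : 0 <= t -> t <= sinh t.
Proof.
move=> t0; rewrite -subr_ge0 -[leLHS](subrr 0) -[X in X - 0]sinh0.
apply: (@is_derive_ge0_le (fun u => sinh u - u) (fun u => cosh u - 1)
  0 t) => //.
  by move=> u; apply: is_deriveB (is_derive_sinh u) (is_derive_id u 1).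
by move=> u _; rewrite subr_ge0 cosh_ge1.
Qed.

Lemma sinh_ge0 t : 0 <= t -> 0 <= sinh t.
Proof. by move=> t0; exact: le_trans (le_sinh t0). Qed.

Lemma sinh_le_mul_cosh t : 0 <= t -> sinh t <= t * cosh t.
Proof.
move=> t0; rewrite -subr_ge0 -[leLHS](subrr 0) -[X in _ - X]sinh0.
rewrite -[X in X - _](mul0r (cosh 0)).
apply: (@is_derive_ge0_le (fun u => u * cosh u - sinh u) (fun u => u * sinh u))
  => // u.
  have /is_derive_eq := is_deriveB
    (is_deriveM (is_derive_id u 1) (is_derive_cosh u)) (is_derive_sinh u).
  by apply; rewrite /= /GRing.scale/=; ring.
by case/andP=> u0 _; rewrite mulr_ge0 ?sinh_ge0.
Qed.

Lemma le_cosh s t : 0 <= s -> s <= t -> cosh s <= cosh t.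
Proof.
move=> s0 st; apply: (is_derive_ge0_le st is_derive_cosh) => u /andP[su _].
exact: sinh_ge0 (le_trans s0 su).
Qed.

(** Monotonicity of [sinh t / t], cleared of denominators. For [u >= s] the derivative
    [s * cosh u - sinh s] is at least [s * cosh s - sinh s], which is nonnegative. *)
Lemma sinh_ratio_le s t : 0 <= s -> s <= t -> t * sinh s <= s * sinh t.
Proof.
move=> s0 st; rewrite -subr_ge0 -[leLHS](subrr (s * sinh s)).
apply: (@is_derive_ge0_le (fun u => s * sinh u - u * sinh s)
  (fun u => s * cosh u - sinh s)) => // u.
  have /is_derive_eq := is_deriveB
    (is_deriveM (is_derive_cst s u 1) (is_derive_sinh u))
    (is_deriveM (is_derive_id u 1) (is_derive_cst (sinh s) u 1)).
  by apply; rewrite /= /GRing.scale /functions.cst /=; ring.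
case/andP=> su _; rewrite subr_ge0 (le_trans (sinh_le_mul_cosh s0))//.
by rewrite ler_wpM2l// le_cosh.
Qed.

(** Since [ln (2 * cosh s) = s + ln (1 + e ^+ 2)] is at most [s + e ^+ 2] with [e = expR (- s)], and
    [cosh s - sinh s = e], it is enough that [sinh s * e = (1 - e ^+ 2) / 2] is at most [s]. *)
Lemma sinh_ln_cosh_le s : 0 <= s -> sinh s * ln (2 * cosh s) <= s * cosh s.
Proof.
move=> s0; set e := expR (- s).
have e0 : 0 < e by exact: expR_gt0.
have ee : expR s * e = 1 by exact: expRxMexpNx_1.
have eee : expR s * e ^+ 2 = e by rewrite expr2 mulrA ee mul1r.
have cE : 2 * cosh s = expR s * (1 + e ^+ 2) by rewrite /cosh -/e; lra.
have e2 : 1 - 2 * s <= e ^+ 2.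
  by rewrite /e -expRM_natr; apply: le_trans (expR_ge1Dx _); lra.
have lnle : ln (2 * cosh s) <= s + e ^+ 2.
  rewrite cE lnM ?posrE ?expR_gt0 ?addr_gt0 ?exprn_gt0// expRK lerD2l.
  by apply: le_ln1Dx; apply: lt_le_trans (sqr_ge0 e); rewrite ltrN10.
apply: le_trans (ler_wpM2l (sinh_ge0 s0) lnle) _.
have ce : cosh s - sinh s = e by rewrite /cosh /sinh -/e; lra.
have sE : sinh s * e = (expR s * e - e ^+ 2) / 2 by rewrite /sinh -/e; ring.
have se : sinh s * e <= s by rewrite sE ee; lra.
suff : e * (sinh s * e) <= s * (cosh s - sinh s) by lra.
by rewrite ce (mulrC s) ler_wpM2l// ltW.
Qed.

(* [m] is the slope of the entropy as a function of [1 / cosh t]; it equals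
   [s / sinh s], extended by its limit [1] at [s = 0]. *)
Lemma sinh_slope s : 0 <= s -> exists m : R,
  [/\ 0 <= m, forall t, 0 <= t <= s -> m * sinh t <= t,
     forall t, s <= t -> t <= m * sinh t &
     cosh s * ln (2 * cosh s) <= s * sinh s + m].
Proof.
rewrite le_eqVlt => /predU1P[<-|s0].
  exists 1; split=> [//|t /andP[t0 t0']|t t0|].
  - have t00 : t = 0 by lra.
    by rewrite t00 sinh0 mulr0.
  - by rewrite mul1r le_sinh.
  (* At [s = 0] the last bound reads [ln 2 <= 1]. *)
  - rewrite cosh0 !mul1r mul0r add0r mulr1.
    by have := @le_ln1Dx R 1 (lt_trans (ltrN10 _) ltr01).
have sh0 : 0 < sinh s by exact: lt_le_trans (le_sinh (ltW s0)).
exists (s / sinh s); split => [|t /andP[t0 ts]|t st|].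
- by rewrite divr_ge0// ltW.
- by rewrite mulrAC ler_pdivrMr// sinh_ratio_le.
- by rewrite mulrAC ler_pdivlMr// sinh_ratio_le// ltW.
(* Multiplied by [sinh s], the right side becomes [s * (sinh s ^+ 2 + 1) = s * cosh s ^+ 2]. *)
- rewrite -(ler_pM2r sh0) [leRHS]mulrDl mulfVK ?gt_eqF//.
  have := ler_wpM2r (ltW (cosh_gt0 s)) (sinh_ln_cosh_le (ltW s0)).
  by have := cosh2B s; have := cosh_gt0 s; nra.
Qed.

(* [entropyh t] is the entropy (in nats) of the weights [e^t / (2 cosh t)] and
   [e^-t / (2 cosh t)]. *)
Definition entropyh t := ln (2 * cosh t) - t * sinh t / cosh t.

Lemma is_derive_entropyh_tangent m t :
  is_derive t 1 (fun u => entropyh u - m / cosh u)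
    ((m * sinh t - t) / cosh t ^+ 2).
Proof.
have c0 := cosh_gt0 t.
have dln : is_derive t 1 (fun u : R => ln (2 * cosh u)) (sinh t / cosh t).
  have dc : is_derive t 1 (fun u : R => 2 * cosh u) (2 * sinh t).
    have /is_derive_eq := is_deriveM
      (is_derive_cst (2 : R) t 1) (is_derive_cosh t).
    by apply; rewrite scaler0 addr0.
  have c20 : 0 < 2 * cosh t by rewrite mulr_gt0.
  have /is_derive_eq := @is_derive1_comp R (@ln R) (fun u => 2 * cosh u) t
    _ _ (is_derive1_ln c20) dc.
  by apply; field; rewrite gt_eqF.
have dm : is_derive t 1 (fun u : R => u * sinh u) (t * cosh t + sinh t).
  have /is_derive_eq := is_deriveM (is_derive_id t 1) (is_derive_sinh t).
  by apply; rewrite /GRing.scale /= mulr1.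
have c0' : cosh t != 0 by rewrite gt_eqF.
have dV := is_deriveV c0' (is_derive_cosh t).
have /is_derive_eq := is_deriveB (is_deriveB dln (is_deriveM dm dV))
  (is_deriveM (is_derive_cst m t 1) dV).
apply; rewrite /= /GRing.scale /functions.cst /=.
(* Inserting [cosh t ^+ 2 - sinh t ^+ 2 = 1] turns the goal into an identity of rational
   functions. *)
have -> : m * sinh t - t = m * sinh t - t * (cosh t ^+ 2 - sinh t ^+ 2).
  by rewrite cosh2B mulr1.
by field.
Qed.

(* The first bound is the tangent inequality at [t = +oo] (product states). *)
Lemma entropyh_tangent s : 0 <= s -> exists2 m : R, 0 <= m &
  entropyh s <= m / cosh s /\
  forall t, 0 <= t -> entropyh s - m / cosh s <= entropyh t - m / cosh t.
Proof.
move=> s0; have [m [m0 ms sm mh]] := sinh_slope s0; exists m => //; split.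
  rewrite /entropyh -(ler_pM2r (cosh_gt0 s)) mulrBl !mulfVK ?gt_eqF ?cosh_gt0//.
  lra.
move=> t t0; have [st|ts] := leP s t.
  apply: (is_derive_ge0_le st (is_derive_entropyh_tangent m)) => u /andP[su _].
  by rewrite divr_ge0 ?sqr_ge0// subr_ge0 sm.
(* To the left of [s] the difference decreases, so its negation is the monotone function. *)
rewrite -[leRHS]opprK -[leLHS]opprK lerN2.
apply: (is_derive_ge0_le (ltW ts)
  (fun u => is_deriveN (is_derive_entropyh_tangent m u))).
move=> u /andP[tu us].
rewrite -mulNr divr_ge0 ?sqr_ge0// opprB subr_ge0 ms//.
by rewrite us (le_trans t0).
Qed.

(** * Binary Shannon entropy, in nats, of squared Schmidt coefficients *)

Definition entropy2 (x y : R) :=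
  - (x ^+ 2 * ln (x ^+ 2) + y ^+ 2 * ln (y ^+ 2)).

Lemma entropy2C x y : entropy2 x y = entropy2 y x.
Proof. by rewrite /entropy2 addrC. Qed.

Lemma sqr_unit_itv (x y : R) : x ^+ 2 + y ^+ 2 = 1 -> 0 <= y ^+ 2 <= 1.
Proof. by have := sqr_ge0 x; have := sqr_ge0 y; lra. Qed.

Lemma entropy2_ge0 x y : x ^+ 2 + y ^+ 2 = 1 -> 0 <= entropy2 x y.
Proof.
move=> xy1.
have := sqr_unit_itv xy1; rewrite addrC in xy1; have := sqr_unit_itv xy1.
move=> /andP[x0 x1] /andP[y0 y1].
by rewrite oppr_ge0 -[leRHS]addr0 lerD// mulr_ge0_le0// ln_le0.
Qed.

Lemma entropy2_product (x : R) : x ^+ 2 + 0 ^+ 2 = 1 -> entropy2 x 0 = 0.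
Proof.
rewrite expr0n addr0 => x1.
by rewrite /entropy2 x1 ln1 expr0n mul0r mulr0 addr0 oppr0.
Qed.

(* [x = e^(t/2) / sqrt (2 cosh t)] and [y = e^(-t/2) / sqrt (2 cosh t)]. *)
Lemma entropy2_hyperbolic (x y : R) : 0 < y -> y <= x -> x ^+ 2 + y ^+ 2 = 1 ->
  exists2 t, 0 <= t & x * y = (2 * cosh t)^-1 /\ entropy2 x y = entropyh t.
Proof.
move=> y0 yx xy1; have x0 := lt_le_trans y0 yx.
pose t := ln x - ln y; have t0 : 0 <= t by rewrite subr_ge0 ler_ln.
have et : expR t = x / y by rewrite expRB !lnK.
have eNt : expR (- t) = y / x by rewrite expRN et invf_div.
have xn0 : x != 0 by rewrite gt_eqF.
have yn0 : y != 0 by rewrite gt_eqF.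
have ch : 2 * cosh t = (x * y)^-1.
  (* Normalization supplies the numerator of [x / y + y / x]. *)
  have -> : (x * y)^-1 = (x ^+ 2 + y ^+ 2) / (x * y) by rewrite xy1 mul1r.
  by rewrite /cosh et eNt; field; rewrite xn0 yn0.
have sh : 2 * sinh t = (x ^+ 2 - y ^+ 2) / (x * y).
  by rewrite /sinh et eNt; field; rewrite xn0 yn0.
exists t => //; split; first by rewrite ch invrK.
rewrite /entropyh -mulrA.
have -> : sinh t / cosh t = x ^+ 2 - y ^+ 2.
  have -> : sinh t / cosh t = 2 * sinh t / (2 * cosh t).
    by field; rewrite gt_eqF ?cosh_gt0.
  by rewrite sh ch invrK mulfVK// mulf_neq0.
rewrite ch lnV ?posrE ?mulr_gt0// lnM ?posrE// /entropy2 !lnXn// /t.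
have -> : y ^+ 2 = 1 - x ^+ 2 by lra.
by ring.
Qed.

(** The tangent inequality in the variable [x * y], half the concurrence. The hyperbolic parameter
    only reaches positive amplitudes, so a vanishing one is treated apart, at the reference point
    and at the compared point. *)
Lemma entropy2_tangent (x0 y0 : R) : 0 <= x0 -> 0 <= y0 ->
  x0 ^+ 2 + y0 ^+ 2 = 1 -> exists2 m : R, 0 <= m &
  forall x y, 0 <= x -> 0 <= y -> x ^+ 2 + y ^+ 2 = 1 ->
    entropy2 x0 y0 + m * (x * y - x0 * y0) <= entropy2 x y.
Proof.
wlog yx0 : x0 y0 / y0 <= x0.
  move=> H x0_ge0 y0_ge0 xy1; have [/H|/ltW/H] := leP y0 x0; first exact.
  by rewrite entropy2C [x0 * y0]mulrC; apply; rewrite // addrC.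
rewrite [0 <= y0]le_eqVlt => x0_ge0 /predU1P[<-|y0_gt0] xy1.
  (* A product state has the least entropy, 0, so a horizontal line lies below. *)
  exists 0 => // x y _ _ xy.
  by rewrite entropy2_product// mul0r addr0 entropy2_ge0.
have [s s0 [c0 ->]] := entropy2_hyperbolic y0_gt0 yx0 xy1.
have [m m0 [ms tm]] := entropyh_tangent s0.
(* The factor 2 passes from slope in [1 / cosh t = 2 * (x * y)] to slope in [x * y]. *)
exists (2 * m) => [|x y]; first by rewrite mulr_ge0.
have mV t : m / cosh t = 2 * m * (2 * cosh t)^-1.
  by field; rewrite gt_eqF ?cosh_gt0.
wlog yx : x y / y <= x.
  move=> H x_ge0 y_ge0 xy1'; have [/H|/ltW/H] := leP y x; first exact.
  by rewrite entropy2C [x * y]mulrC; apply; rewrite // addrC.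
rewrite [0 <= y]le_eqVlt => x_ge0 /predU1P[<-|y_gt0] xy1'.
  (* The compared state is a product: this is the bound at infinite [t]. *)
  rewrite entropy2_product// mulr0 sub0r c0 mulrN -mV; lra.
have [t t0 [c ->]] := entropy2_hyperbolic y_gt0 yx xy1'.
by have := tm t t0; rewrite c c0 mulrBr -!mV; lra.
Qed.

End Hyperbolic.

Section Qubits.
Variable R : realType.
Local Notation C := R[i].
Local Notation normc := (@ComplexField.Normc.normc R).

(** * Von Neumann entropy from the spectrum *)

Lemma normal_vN_entropyE n (rho : 'M[C]_n) : rho \is normalmx ->
  vN_entropy rho =
  - complex.Re (\sum_i spectral_diag rho 0 i *
      (log2 (complex.Re (spectral_diag rho 0 i)))%:C).
Proof.
move=> /orthomx_spectralP rhoE; rewrite /vN_entropy; congr (- complex.Re _).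
set P := spectralmx rho in rhoE *; set d := spectral_diag rho in rhoE *.
have Pu : P \in unitmx by exact: spectral_unit.
rewrite {1}rhoE /hermfun -/P -/d !mulmxA mulmxK// mxtrace_mulC !mulmxA.
rewrite mulmxV// mul1mx mulmx_diag mxtrace_diag.
by apply: eq_bigr => i _; rewrite !mxE.
Qed.

Lemma spectral_diag_tr_det n (rho : 'M[C]_n) : rho \is normalmx ->
  \tr rho = \sum_i spectral_diag rho 0 i /\
  \det rho = \prod_i spectral_diag rho 0 i.
Proof.
move=> /orthomx_spectralP rhoE.
set P := spectralmx rho in rhoE *; set d := spectral_diag rho in rhoE *.
have Pu : P \in unitmx by exact: spectral_unit.
split; rewrite rhoE.
  by rewrite mxtrace_mulC mulmxA mulmxV// mul1mx mxtrace_diag.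
by rewrite !det_mulmx mulrC mulrA -det_mulmx mulmxV// det1 mul1r det_diag.
Qed.

Lemma ord2P (i : 'I_2) : i = 0 \/ i = 1.
Proof. by case: i => [[|[|//]] ?]; [left|right]; apply: val_inj. Qed.

Lemma sum_ord2 (V : nmodType) (F : 'I_2 -> V) : \sum_i F i = F 0 + F 1.
Proof.
by rewrite !big_ord_recl big_ord0 addr0; congr (_ + F _); apply: val_inj.
Qed.

(** The order in which [spectral_diag] lists eigenvalues is not known, even for a diagonal matrix.
    Trace and determinant fix them up to a swap, under which the entropy is symmetric. *)
Lemma vN_entropy_diag2 (x y : R) :
  vN_entropy (diag_mx (\row_(j < 2) (if j == 0 then x else y)%:C)) =
  - (x * log2 x + y * log2 y).
Proof.
set rho := diag_mx _.
have rhon : rho \is normalmx.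
  by apply/normalmxP; rewrite tr_diag_mx map_diag_mx diag_mxC.
have [] := spectral_diag_tr_det rhon; rewrite normal_vN_entropyE//.
move: (spectral_diag rho) => d.
rewrite det_diag mxtrace_diag !sum_ord2.
rewrite !big_ord_recl !big_ord0 !mulr1 !mxE /=.
have -> : lift ord0 ord0 = 1 :> 'I_2 by apply: val_inj.
move: (d 0 0) (d 0 1) => u v dD dM.
have : (u - x%:C) * (u - y%:C) = 0.
  have -> : (u - x%:C) * (u - y%:C) =
      u * (u - (x%:C + y%:C)) + x%:C * y%:C by ring.
  by rewrite dD dM; ring.
move/eqP; rewrite mulf_eq0 !subr_eq0 => /orP[]/eqP uE.
  have vE : v = y%:C by rewrite uE in dD; apply: (addrI x%:C).
  by rewrite uE vE /= !mul0r !subr0.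
have vE : v = x%:C by rewrite uE addrC in dD; apply: (addrI y%:C).
by rewrite uE vE /= !mul0r !subr0 addrC.
Qed.

(** * Entries of Choi vectors and Choi states *)

Lemma sum_mxtens (V : nmodType) m n (F : 'I_(m * n) -> V) :
  \sum_i F i = \sum_i \sum_j F (mxtens_index (i, j)).
Proof.
rewrite (reindex (@mxtens_index m n)) /=; last first.
  by exists (@mxtens_unindex m n) => i _;
    rewrite (mxtens_indexK, mxtens_unindexK).
by rewrite pair_bigA; apply: eq_bigr => -[].
Qed.

Lemma omegaE k l :
  omega R (mxtens_index (k, l)) 0 = ((Num.sqrt 2)^-1 *+ (k == l))%:C.
Proof.
rewrite /omega !mxE !mxtens_indexK /= !andbT.
by case: k l => [[|[|//]] ?] [[|[|//]] ?];
  rewrite !(mulr1, mulr0, addr0, add0r, mulr1n, mulr0n).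
Qed.

Lemma kraus_vecE (A : 'M[C]_2) i k :
  kraus_vec A (mxtens_index (i, k)) 0 = ((Num.sqrt 2)^-1)%:C * A i k.
Proof.
rewrite mxE sum_mxtens mulrC.
under eq_bigr => j _.
  under eq_bigr => l _ do rewrite tensmxE omegaE mxE.
  rewrite (bigD1 k)//= big1 => [|l lk].
    rewrite addr0 eqxx mulr1; over.
  by rewrite eq_sym (negbTE lk) mulr0 mul0r.
rewrite (bigD1 k)//= big1 => [|l /negbTE lk].
  by rewrite addr0 eqxx.
by rewrite lk mulr0.
Qed.

Lemma projE n (v : 'cV[C]_n) i j : proj v i j = v i 0 * (v j 0)^*.
Proof. by rewrite mxE big_ord1 !mxE. Qed.

Lemma on_firstE (N : {linear 'M[C]_2 -> 'M[C]_2}) X i k j l :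
  on_first N X (mxtens_index (i, k)) (mxtens_index (j, l)) =
  N (\matrix_(i, j) X (mxtens_index (i, k)) (mxtens_index (j, l))) i j.
Proof.
rewrite summxE (bigD1 k)//= [X in _ + X]big1 => [|k' /negbTE kk']; last first.
  rewrite summxE big1// => l' _.
  by rewrite tensmxE mxE eq_sym kk' mulr0.
rewrite addr0 summxE (bigD1 l)//=.
rewrite [X in _ + X]big1 => [|l' /negbTE ll']; last first.
  by rewrite tensmxE mxE [l == _]eq_sym ll' andbF mulr0.
by rewrite addr0 tensmxE mxE !eqxx mulr1.
Qed.

Lemma sqrt2V_sqr : (Num.sqrt 2)^-1 * (Num.sqrt 2)^-1 = 2^-1 :> R.
Proof. by rewrite -expr2 exprVn sqr_sqrtr. Qed.

Lemma conj_real (x : R) : (x%:C)^*%R = x%:C :> C.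
Proof. exact: conjc_real. Qed.

Lemma choiE n (K : 'I_n -> 'M[C]_2) (N : {linear 'M[C]_2 -> 'M[C]_2}) :
  kraus_decomposition K N -> choi N = \sum_r proj (kraus_vec (K r)).
Proof.
move=> KN; apply/matrixP => a b.
case: (mxtens_indexP a) => i k; case: (mxtens_indexP b) => j l.
rewrite on_firstE KN !summxE; apply: eq_bigr => r _.
(* The channel acts on [|k><l| / 2], a column times a row, so each Kraus term factors into a column
   of [K r] and a conjugated one. *)
have -> : \matrix_(i', j')
    proj (omega R) (mxtens_index (i', k)) (mxtens_index (j', l))
    = (2^-1)%:C *: (delta_mx k 0 *m delta_mx (0 : 'I_1) l).
  apply/matrixP => i' j'; rewrite mxE projE !omegaE mul_delta_mx !mxE.
  rewrite conj_real -rmorphM.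
  case: (i' == k); case: (j' == l);
    rewrite ?mulr0n ?mulr0 ?mul0r ?rmorph0 ?mulr1n //=.
  by rewrite sqrt2V_sqr mulr1.
rewrite -scalemxAr -scalemxAl mulmxA -colE -mulmxA -rowE mxE.
rewrite [X in _ * X]mxE big_ord1 projE !kraus_vecE !mxE.
by rewrite [in RHS]rmorphM /= conj_real [RHS]mulrACA -rmorphM sqrt2V_sqr.
Qed.

(** * Entanglement of ensembles and its lower bound *)

Lemma normcE (z : C) : (normc z)%:C = `|z|.
Proof. by []. Qed.

Lemma sqr_normc (z : C) : (normc z ^+ 2)%:C = z * z^*.
Proof. by rewrite rmorphXn /= normcE normCK. Qed.

Lemma sqnormE n (v : 'cV[C]_n) : (sqnorm v)%:C = \sum_i v i 0 * (v i 0)^*.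
Proof. by rewrite rmorph_sum; apply: eq_bigr => i _; rewrite /= sqr_normc. Qed.

(** Such a vector is in Schmidt form up to phases, so its reduced state is diagonal; [ln 2] converts
    nats to bits. *)
Lemma entanglement_schmidt (phi : 'cV[C]_(2 * 2)) :
  phi (mxtens_index (0, 1)) 0 = 0 -> phi (mxtens_index (1, 0)) 0 = 0 ->
  entanglement phi = entropy2 (normc (phi (mxtens_index (0, 0)) 0))
    (normc (phi (mxtens_index (1, 1)) 0)) / ln 2.
Proof.
move=> p01 p10; set x := normc _; set y := normc _.
rewrite /entanglement.
have -> : ptrace2 (proj phi) =
    diag_mx (\row_(j < 2) (if j == 0 then x ^+ 2 else y ^+ 2)%:C).
  apply/matrixP => i j; rewrite mxE sum_ord2 !projE !mxE.
  have [->|->] := ord2P i; have [->|->] := ord2P j;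
    rewrite !(p01, p10, mul0r, conjC0, mulr0, addr0, add0r, mulr1n, mulr0n)//.
    by rewrite -sqr_normc.
  by rewrite -sqr_normc.
by rewrite vN_entropy_diag2 /entropy2 /log2 mulNr mulrDl !mulrA.
Qed.

Lemma ensemble_entry d (rho : 'M[C]_d) k (q : 'I_k -> R) phi a b :
  is_ensemble rho q phi ->
  rho a b = \sum_i (q i)%:C * (phi i a 0 * (phi i b 0)^*).
Proof.
by case=> _ _ _ ->; rewrite summxE; apply: eq_bigr => i _; rewrite mxE projE.
Qed.

(** A diagonal entry is a sum of nonnegative terms, so when it is 0 every term is. States of weight
    0 stay unconstrained. *)
Lemma ensemble_support d (rho : 'M[C]_d) k (q : 'I_k -> R) phi a i :
  is_ensemble rho q phi -> rho a a = 0 -> q i != 0 -> phi i a 0 = 0.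
Proof.
move=> ens; rewrite (ensemble_entry _ _ ens) => rho0 qi0.
have [q_ge0 _ _ _] := ens.
have : \sum_i q i * normc (phi i a 0) ^+ 2 = 0.
  apply: (@complexI R); rewrite rmorph_sum /= -[RHS]rho0.
  by apply: eq_bigr => j _; rewrite -sqr_normc -rmorphM.
move/(psumr_eq0P (fun j _ => mulr_ge0 (q_ge0 j) (sqr_ge0 _)))/(_ i isT)/eqP.
rewrite mulf_eq0 (negbTE qi0) expf_eq0 /= => /eqP.
exact: ComplexField.Normc.eq0_normc.
Qed.

Lemma normc_ge0 (z : C) : 0 <= normc z.
Proof. by case: z => a b; exact: sqrtr_ge0. Qed.

Lemma ler_ensemble_entry d (rho : 'M[C]_d) k (q : 'I_k -> R) phi a b :
  is_ensemble rho q phi ->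
  normc (rho a b) <= \sum_i q i * (normc (phi i a 0) * normc (phi i b 0)).
Proof.
move=> ens; have [q_ge0 _ _ _] := ens; rewrite (ensemble_entry _ _ ens).
rewrite -lecR rmorph_sum /= normcE.
apply: le_trans (ler_norm_sum _ _ _) _; apply: ler_sum => i _.
by rewrite !normrM norm_conjC !rmorphM /= !normcE ger0_norm// ler0c.
Qed.

Lemma sqnorm_mxtens (phi : 'cV[C]_(2 * 2)) :
  phi (mxtens_index (0, 1)) 0 = 0 -> phi (mxtens_index (1, 0)) 0 = 0 ->
  sqnorm phi = normc (phi (mxtens_index (0, 0)) 0) ^+ 2 +
               normc (phi (mxtens_index (1, 1)) 0) ^+ 2.
Proof.
move=> p01 p10; rewrite /sqnorm sum_mxtens !sum_ord2 p01 p10.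
by rewrite ComplexField.Normc.normc0 expr0n /= addr0 add0r.
Qed.

(** The reference amplitudes [x0], [y0] carry the coherence of [rho]. Averaging the tangent
    inequality leaves [m] times the excess of the mean of [x i * y i] over [x0 * y0], which the
    triangle inequality makes nonnegative. *)
Lemma average_entanglement_ge (rho : 'M[C]_(2 * 2)) (x0 y0 : R)
    k (q : 'I_k -> R) phi :
  is_ensemble rho q phi -> 0 <= x0 -> 0 <= y0 -> x0 ^+ 2 + y0 ^+ 2 = 1 ->
  rho (mxtens_index (0, 1)) (mxtens_index (0, 1)) = 0 ->
  rho (mxtens_index (1, 0)) (mxtens_index (1, 0)) = 0 ->
  rho (mxtens_index (0, 0)) (mxtens_index (1, 1)) = (x0 * y0)%:C ->
  entropy2 x0 y0 / ln 2 <= average_entanglement q phi.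
Proof.
move=> ens x0_ge0 y0_ge0 xy1 r01 r10 r0011; have [q_ge0 q1 phi1 _] := ens.
have [m m_ge0 tangent] := entropy2_tangent x0_ge0 y0_ge0 xy1.
pose x i := normc (phi i (mxtens_index (0, 0)) 0).
pose y i := normc (phi i (mxtens_index (1, 1)) 0).
have ln2 : 0 < ln (2 : R) by rewrite ln_gt0// ltr1n.
rewrite ler_pdivrMr// mulr_suml.
have coherence : x0 * y0 <= \sum_i q i * (x i * y i).
  apply: le_trans (ler_ensemble_entry _ _ ens); rewrite r0011.
  by rewrite -lecR normcE ger0_norm// ler0c mulr_ge0.
apply: (@le_trans _ _
  (\sum_i q i * (entropy2 x0 y0 + m * (x i * y i - x0 * y0)))).
  under eq_bigr => i _ do rewrite mulrDr mulrCA [X in m * X]mulrBr.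
  rewrite big_split /= -mulr_suml q1 mul1r lerDl -mulr_sumr mulr_ge0//.
  by rewrite sumrB -mulr_suml q1 mul1r subr_ge0.
apply: ler_sum => i _; have [->|qi0] := eqVneq (q i) 0; first by rewrite !mul0r.
have p01 := ensemble_support ens r01 qi0.
have p10 := ensemble_support ens r10 qi0.
rewrite (entanglement_schmidt p01 p10) mulrA mulfVK ?gt_eqF//.
rewrite ler_wpM2l// tangent ?normc_ge0//.
by rewrite -sqnorm_mxtens.
Qed.

(** The minimizing ensemble provides both the nonemptiness and the lower bound that keep [inf] from
    being a default value. *)
Lemma EoF_eq m n (rho : 'M[C]_(m * n)) k (q : 'I_k -> R) phi :
  is_ensemble rho q phi ->
  (forall k' (q' : 'I_k' -> R) phi', is_ensemble rho q' phi' ->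
    average_entanglement q phi <= average_entanglement q' phi') ->
  average_entanglement q phi = EoF rho.
Proof.
move=> ens le_avg; apply/le_anti/andP; split.
  apply: lb_le_inf; first by exists (average_entanglement q phi), k, q, phi.
  by move=> _ [k' [q' [phi' [ens' ->]]]]; exact: le_avg.
apply: ge_inf; last by exists k, q, phi.
exists (average_entanglement q phi).
by move=> _ [k' [q' [phi' [ens' ->]]]]; exact: le_avg.
Qed.

(** * Rotated Kraus operators and the ensembles they induce *)

Lemma kraus_map_rotate k' k (U : 'M[C]_(k', k)) (K : 'I_k -> 'M[C]_2) :
  U ^t* *m U = 1%:M -> kraus_decomposition (rotate_kraus U K) (kraus_map K).
Proof.
move=> U1 X; rewrite /kraus_map /rotate_kraus.
have U1E i j : \sum_i' U i' j * (U i' i)^* = (i == j)%:R.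
  move/matrixP/(_ i j): U1; rewrite !mxE => <-.
  by apply: eq_bigr => i' _; rewrite !mxE mulrC.
(* The coefficients are inner products of columns of [U]: orthonormality kills the cross terms, and
   expanding the rotated operators gives the same double sum. *)
transitivity (\sum_i \sum_j
    (\sum_i' U i' i * (U i' j)^*) *: (K i *m X *m (K j)^t*)).
  apply: eq_bigr => i _; rewrite (bigD1 i)//=.
  rewrite [X in _ + X]big1 ?addr0 => [|j /negbTE ji].
    by rewrite U1E eqxx scale1r.
  by rewrite U1E ji scale0r.
under eq_bigr => i _.
  under eq_bigr => j _ do rewrite scaler_suml.
  rewrite exchange_big /=; over.
rewrite exchange_big /=; apply: eq_bigr => i' _.
rewrite mulmx_suml mulmx_suml; apply: eq_bigr => i _.
rewrite raddf_sum raddf_sum mulmx_sumr; apply: eq_bigr => j _.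
by rewrite /= linearZ /= map_mxZ -!scalemxAl -scalemxAr scalerA.
Qed.

(** Positive probabilities exclude the zero-vector default of [kraus_state], so every state is a
    unit vector. *)
Lemma kraus_ensemble k (K : 'I_k -> 'M[C]_2) (N : {linear 'M[C]_2 -> 'M[C]_2}) :
  kraus_decomposition K N -> (forall i, 0 < kraus_prob K i) ->
  \sum_i kraus_prob K i = 1 ->
  is_ensemble (choi N) (kraus_prob K) (kraus_state K).
Proof.
move=> KN p0 p1.
have sqrtV i : (Num.sqrt (kraus_prob K i))^-1 ^+ 2 = (kraus_prob K i)^-1.
  by rewrite exprVn sqr_sqrtr ?ltW.
have cV i : let c := ((Num.sqrt (kraus_prob K i))^-1)%:C : C in
    c * c^* = ((kraus_prob K i)^-1)%:C.
  by rewrite /= conj_real -rmorphM -expr2 sqrtV.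
split=> // [i|i|]; first exact: ltW.
  apply: (@complexI R); rewrite sqnormE.
  under eq_bigr => j _ do rewrite mxE rmorphM /= mulrACA cV.
  by rewrite -mulr_sumr -sqnormE -rmorphM /= mulVf// gt_eqF.
rewrite (choiE KN); apply: eq_bigr => i _; apply/matrixP => a b.
have stateE a' : kraus_state K i a' 0 =
    ((Num.sqrt (kraus_prob K i))^-1)%:C * kraus_vec (K i) a' 0 by rewrite mxE.
rewrite [RHS]mxE !projE !stateE rmorphM /= mulrACA cV [RHS]mulrA.
by rewrite -rmorphM mulfV ?gt_eqF// mul1r.
Qed.

Lemma hadamardE i j : hadamard R i j = ((Num.sqrt 2)^-1 * (-1) ^+ (i * j))%:C.
Proof. by rewrite !mxE rmorphM rmorphXn /= rmorphN1. Qed.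

Lemma hadamard_unitary : (hadamard R) ^t* *m hadamard R = 1%:M.
Proof.
have s2 := sqrt2V_sqr.
have trE i j : (hadamard R) ^t* i j = ((Num.sqrt 2)^-1 * (-1) ^+ (j * i))%:C.
  by rewrite 2!mxE hadamardE conj_real.
apply/matrixP => i j; rewrite mxE sum_ord2 !trE !hadamardE.
rewrite -!rmorphM -rmorphD mxE.
have [->|->] := ord2P i; have [->|->] := ord2P j;
  rewrite /= -[RHS](rmorph_nat (real_complex R)) /=; congr (_%:C);
  rewrite /= ?expr0 ?expr1; lra.
Qed.

(** The sign combines [(-1) ^+ r] from [hadamard] with [(-1) ^+ i] from [pauliZ]. Hence both
    operators have the same two diagonal entries, in opposite orders. *)
Lemma rotated_krausE p r i j :
  rotate_kraus (hadamard R) (dephasing_kraus p) r i j =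
    ((Num.sqrt 2)^-1 *
      (Num.sqrt (1 - p / 2) + (-1) ^+ (r + i) * Num.sqrt (p / 2))
      *+ (i == j))%:C.
Proof.
have K0 : dephasing_kraus p 0 i j = (Num.sqrt (1 - p / 2) *+ (i == j))%:C.
  rewrite /dephasing_kraus /= 2!mxE.
  by case: (i == j); rewrite ?mulr1 ?mulr0.
have K1 : dephasing_kraus p 1 i j =
    ((-1) ^+ i * Num.sqrt (p / 2) *+ (i == j))%:C.
  rewrite /dephasing_kraus /= 3!mxE.
  have [_|_] := eqVneq i j; last by rewrite mulr0.
  by rewrite !mulr1n rmorphM /= rmorphXn /= rmorphN1 mulrC.
rewrite /rotate_kraus sum_ord2 mxE [X in X + _]mxE [X in _ + X]mxE.
rewrite K0 K1 !hadamardE -!rmorphM -rmorphD; congr (_%:C).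
rewrite muln0 muln1 exprD.
case: (i == j); rewrite ?mulr1n ?mulr0n /=; ring.
Qed.

Lemma sqrt_compl_half (p : R) : 0 <= p <= 1 ->
  let a := Num.sqrt (1 - p / 2) in let b := Num.sqrt (p / 2) in
  [/\ a ^+ 2 + b ^+ 2 = 1, 0 <= b & b <= a].
Proof.
case/andP=> p0 p1; rewrite /= !sqr_sqrtr; try lra.
by split; rewrite ?sqrtr_ge0 ?ler_wsqrtr//; lra.
Qed.

End Qubits.

Theorem proposition8 (R : realType) (p : R) (p01 : 0 <= p <= 1) :
  choi_optimal (rotate_kraus (hadamard R) (dephasing_kraus p))
    (kraus_map (dephasing_kraus p)).
Proof.
set K := rotate_kraus _ _; set N := kraus_map _ : {linear _ -> _}.
have KN : kraus_decomposition K N by exact/kraus_map_rotate/hadamard_unitary.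
split; first exact: KN.
have [ab1 b0 ba] := sqrt_compl_half p01.
set a := Num.sqrt (1 - p / 2) in ab1 ba *.
set b := Num.sqrt (p / 2) in ab1 b0 ba *.
have s2 : (Num.sqrt 2)^-1 * (Num.sqrt 2)^-1 = 2^-1 :> R := sqrt2V_sqr R.
have s0 : 0 < (Num.sqrt 2)^-1 :> R by rewrite invr_gt0 sqrtr_gt0.
set s := (Num.sqrt 2)^-1 in s2 s0.
(* Amplitudes of the rotated states after normalization; [x0 * y0 = (a ^+ 2 - b ^+ 2) / 2 = (1 - p)
   / 2] is the coherence of the Choi state. *)
pose x0 := s * (a + b); pose y0 := s * (a - b).
have x0_ge0 : 0 <= x0 by rewrite mulr_ge0 ?(ltW s0)//; lra.
have y0_ge0 : 0 <= y0 by rewrite mulr_ge0 ?(ltW s0)//; lra.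
have xy1 : x0 ^+ 2 + y0 ^+ 2 = 1.
  have -> : x0 ^+ 2 + y0 ^+ 2 = (s * s) * (2 * (a ^+ 2 + b ^+ 2)).
    by rewrite /x0 /y0; ring.
  by rewrite s2 ab1; lra.
have normR (t : R) : 0 <= t -> ComplexField.Normc.normc t%:C = t.
  by move=> t0; rewrite /= expr0n addr0 sqrtr_sqr ger0_norm.
have vec r i k : kraus_vec (K r) (mxtens_index (i, k)) 0 =
    (s * (if i != k then 0 else if r == i then x0 else y0))%:C.
  rewrite kraus_vecE rotated_krausE -rmorphM /=; congr (_ * _)%:C.
  have [_|//] := eqVneq i k; rewrite mulr1n /x0 /y0 -/s -/a -/b.
  by have [->|->] := ord2P r; have [->|->] := ord2P i;
    rewrite /= ?expr0 ?expr1; ring.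
have prob r : kraus_prob K r = 2^-1.
  rewrite /kraus_prob sqnorm_mxtens ?vec ?mulr0// !normR ?mulr_ge0 ?(ltW s0)//=;
    try by case: ifP.
  rewrite !exprMn -mulrDr expr2 s2.
  by have [->|->] := ord2P r; rewrite /= ?[y0 ^+ 2 + _]addrC xy1 mulr1.
have ens : is_ensemble (choi N) (kraus_prob K) (kraus_state K).
  apply: kraus_ensemble => // [r|]; rewrite ?prob ?invr_gt0//.
  by rewrite sum_ord2 !prob; lra.
have state r i k : kraus_state K r (mxtens_index (i, k)) 0 =
    (if i != k then 0 else if r == i then x0 else y0)%:C.
  (* Dividing by the square root of the probability [2^-1] cancels the factor [s]. *)
  rewrite mxE vec prob sqrtrV// invrK -rmorphM /= mulrA /s mulfV ?mul1r//.
  by rewrite gt_eqF ?sqrtr_gt0.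
apply: EoF_eq ens _ => n q phi ens_phi.
have -> : average_entanglement (kraus_prob K) (kraus_state K) =
    entropy2 x0 y0 / ln 2.
  have stateN r i k : i != k -> kraus_state K r (mxtens_index (i, k)) 0 = 0.
    by move=> ik; rewrite state ik.
  (* The two states differ by exchanging [x0] and [y0], so the average is their common entropy. *)
  have ent r : entanglement (kraus_state K r) = entropy2 x0 y0 / ln 2.
    have [st01 st10] := (stateN r 0 1 isT, stateN r 1 0 isT).
    rewrite (entanglement_schmidt st01 st10) !state !eqxx.
    have [->|->] := ord2P r; first by rewrite eqxx !normR.
    by rewrite eqxx !normR // entropy2C.
  rewrite /average_entanglement; under eq_bigr => r _ do rewrite prob ent mulrC.
  by rewrite sum_ord2 -splitr.
have choi_entry i j k l : choi N (mxtens_index (i, k)) (mxtens_index (j, l)) =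
   \sum_r ((s * (if i != k then 0 else if r == i then x0 else y0)) *
           (s * (if j != l then 0 else if r == j then x0 else y0)))%:C.
  rewrite (choiE KN) summxE; apply: eq_bigr => r _.
  by rewrite projE !vec conj_real -rmorphM.
apply: (average_entanglement_ge ens_phi) => //; rewrite choi_entry sum_ord2 /=.
- by rewrite !(mulr0, mul0r) addr0.
- by rewrite !(mulr0, mul0r) addr0.
- rewrite -rmorphD; congr (_%:C).
  (* Each rotated vector contributes [s * s * (x0 * y0)], half of the coherence. *)
  have -> : s * x0 * (s * y0) + s * y0 * (s * x0) = (s * s) * (2 * (x0 * y0)).
    by ring.
  by rewrite s2; lra.
Qed.
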